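(* There exist nonnegative $3$-dimensional matrices $A$ and $B$ such that $\operatorname{per}B=0$ but $\operatorname{per}(A\otimes B)>0$, where $\otimes$ denotes the Kronecker product.
   Context: Let $I_n^d = \{1,\ldots,n\}^d$ with $n,d$ positive integers. A $d$-dimensional matrix $A$ of order $n$ is an array $(a_\alpha)_{\alpha\in I_n^d}$ of real numbers; it is nonnegative if all $a_\alpha\ge0$. A diagonal in a $d$-dimensional matrix of order $n$ is a set of indices $\{\alpha^1,\ldots,\alpha^n\}\subset I_n^d$ such that $\alpha^i_k\ne\alpha^j_k$ for all $k\in\{1,\ldots,d\}$ and all $i\neq j$. With $\mathcal{D}(A)$ the set of all diagonals, the permanent of $A$ is $\operatorname{per}A=\sum_{D\in\mathcal{D}(A)}\prod_{\alpha\in D}a_\alpha$. The Kronecker product $A\otimes B$ of a $d$-dimensional matrix $A$ of order $n_1$ and a $d$-dimensional matrix $B$ of order $n_2$ is the $d$-dimensional matrix $C$ of order $n_1n_2$ with entries $c_\gamma = a_\alpha b_\beta$, where $\gamma_i = (\alpha_i-1)n_2+\beta_i$ for each $i=1,\ldots,d$. *)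

(* Defs.v *)
From HB Require Import structures.
From mathcomp Require Import all_boot all_order all_algebra reals.

Set Implicit Arguments.
Unset Strict Implicit.
Unset Printing Implicit Defensive.

Import Order.TTheory GRing.Theory Num.Theory.
Local Open Scope ring_scope.

(* The index set I_n^d; coordinates and index values are counted from 0. *)
Definition mindex (d n : nat) := {ffun 'I_d -> 'I_n}.

Definition mdmatrix (R : Type) (d n : nat) := {ffun mindex d n -> R}.

Definition nonneg_mdmatrix (R : realType) d n (A : mdmatrix R d n) : Prop :=
  forall alpha, 0 <= A alpha.

(* The cardinality clause renders the n pairwise distinct indices
   alpha^1, ..., alpha^n of a diagonal, which is an unordered set. *)
Definition is_diagonal d n (D : {set mindex d n}) : bool :=
  (#|D| == n) &&
  [forall alpha in D, forall beta in D,
     (alpha != beta) ==> [forall k, alpha k != beta k]].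

Definition per (R : realType) d n (A : mdmatrix R d n) : R :=
  \sum_(D : {set mindex d n} | is_diagonal D) \prod_(alpha in D) A alpha.

Section KroneckerIndex.
Variables d n1 n2 : nat.

Lemma kron_divP (i : 'I_(n1 * n2)) : (i %/ n2 < n1)%N.
Proof.
case: n2 i => [|m] i; last by rewrite ltn_divLR.
by have := ltn_ord i; rewrite [in X in (_ < X)%N -> _]muln0 ltn0.
Qed.

Lemma kron_modP (i : 'I_(n1 * n2)) : (i %% n2 < n2)%N.
Proof.
case: n2 i => [|m] i; last by rewrite ltn_mod.
by have := ltn_ord i; rewrite [in X in (_ < X)%N -> _]muln0 ltn0.
Qed.

Lemma kron_pairP (a : 'I_n1) (b : 'I_n2) : (a * n2 + b < n1 * n2)%N.
Proof.
apply: (@leq_trans (a.+1 * n2)%N); last by rewrite leq_mul2r (ltn_ord a) orbT.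
by rewrite mulSn addnC ltn_add2r.
Qed.

(* With indices counted from 0, gamma_i = (alpha_i - 1) n2 + beta_i reads
   gamma_i = alpha_i n2 + beta_i; kron_fst and kron_snd recover alpha and
   beta from gamma. *)
Definition kron_pair (alpha : mindex d n1) (beta : mindex d n2) :
    mindex d (n1 * n2) :=
  [ffun k => Ordinal (kron_pairP (alpha k) (beta k))].

Definition kron_fst (gamma : mindex d (n1 * n2)) : mindex d n1 :=
  [ffun k => Ordinal (kron_divP (gamma k))].

Definition kron_snd (gamma : mindex d (n1 * n2)) : mindex d n2 :=
  [ffun k => Ordinal (kron_modP (gamma k))].

Lemma kron_fst_pair alpha beta : kron_fst (kron_pair alpha beta) = alpha.
Proof.
apply/ffunP => k; apply/val_inj; rewrite !ffunE /=.
have n2_gt0 : (0 < n2)%N by apply: leq_ltn_trans (ltn_ord (beta k)).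
by rewrite divnMDl // divn_small ?addn0.
Qed.

Lemma kron_snd_pair alpha beta : kron_snd (kron_pair alpha beta) = beta.
Proof.
by apply/ffunP => k; apply/val_inj; rewrite !ffunE /= modnMDl modn_small.
Qed.

Lemma kron_pairK gamma : kron_pair (kron_fst gamma) (kron_snd gamma) = gamma.
Proof.
by apply/ffunP => k; apply/val_inj; rewrite !ffunE /= -divn_eq.
Qed.

End KroneckerIndex.

Definition kron (R : realType) d n1 n2
    (A : mdmatrix R d n1) (B : mdmatrix R d n2) : mdmatrix R d (n1 * n2) :=
  [ffun gamma => A (kron_fst gamma) * B (kron_snd gamma)].

Lemma kronE (R : realType) d n1 n2 (A : mdmatrix R d n1) (B : mdmatrix R d n2)
    (alpha : mindex d n1) (beta : mindex d n2) :
  kron A B (kron_pair alpha beta) = A alpha * B beta.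
Proof. by rewrite ffunE kron_fst_pair kron_snd_pair. Qed.

(* Main.v *)
Require Import Defs.
From mathcomp Require Import all_boot all_order all_algebra reals.
Import Order.TTheory GRing.Theory Num.Theory.
Local Open Scope ring_scope.

(** Let B be the indicator of the indices of even coordinate sum in
    {0,1}^3, that is, of the four triples (p, q, p + q) over F_2.  Two indices
    of {0,1}^3 that differ everywhere are complementary, so their coordinate
    sums add up to the odd number 3 and one of them is odd: a diagonal cannot
    lie in the support of B ([per_even_matrix]).  In this support, however,
    each value of each coordinate occurs exactly twice: a fractional diagonal
    of weight 1/2.  The product with the all-one matrix A of order 2 replaces
    each index value by two copies of it, and the four triples can use these
    copies so that none is used twice.  Explicitly, the copy of the triple
    (p, q, p + q) is labelled (q, p, p): the label and the value in each
    coordinate, (q, p), (p, q) and (p, p + q), together determine p and q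
    ([lifted_triple_inj]).  The lifted triples are then a diagonal of A (x) B
    on which all entries are 1, which suffices by [per_gt0]. *)

Lemma image_is_diagonal d n (T : finType) (f : T -> mindex d n) :
  (0 < d)%N -> #|T| = n -> (forall k, injective (fun t => f t k)) ->
  is_diagonal [set f t | t : T].
Proof.
move=> d_gt0 cardT f_inj; apply/andP; split.
  rewrite card_imset ?cardT // => s t eq_f.
  by apply: (f_inj (Ordinal d_gt0)); rewrite /= eq_f.
apply/'forall_implyP => _ /imsetP[s _ ->].
apply/'forall_implyP => _ /imsetP[t _ ->].
apply/implyP => neq_f; apply/forallP => k.
by apply: contra neq_f => /eqP/f_inj->.
Qed.

(** With nonnegative entries nothing cancels: one diagonal inside the support
    is enough. *)
Lemma per_gt0 (R : realType) d n (A : mdmatrix R d n) (D : {set mindex d n}) :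
  nonneg_mdmatrix A -> is_diagonal D -> (forall alpha, alpha \in D -> 0 < A alpha) ->
  0 < per A.
Proof.
move=> A_ge0 diagD A_gt0; rewrite /per (bigD1 D) //=.
apply: ltr_pwDl; first exact: prodr_gt0.
by apply: sumr_ge0 => E _; apply: prodr_ge0.
Qed.

Lemma nonneg_kron (R : realType) d n1 n2
    (A : mdmatrix R d n1) (B : mdmatrix R d n2) :
  nonneg_mdmatrix A -> nonneg_mdmatrix B -> nonneg_mdmatrix (kron A B).
Proof. by move=> A_ge0 B_ge0 gamma; rewrite ffunE mulr_ge0. Qed.

Definition even_matrix (R : realType) : mdmatrix R 3 2 :=
  [ffun beta : mindex 3 2 => (~~ odd (\sum_k beta k))%:R].

(** The two indices of a diagonal of order 2 are complementary, so their
    coordinate sums add up to 3: one of the two entries vanishes. *)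
Lemma per_even_matrix (R : realType) : per (even_matrix R) = 0.
Proof.
apply: big1 => D /andP[/cards2P[a [b [neq_ab ->]]]] /'forall_implyP diagD.
have /forallP compl : [forall k, a k != b k].
  have /'forall_implyP /(_ b) := diagD a (set21 a b).
  by rewrite set22 => /(_ isT) /implyP; apply.
have sum1 k : (a k + b k = 1)%N.
  by move: (a k) (b k) (compl k) => [[|[|?]] ?] [[|[|?]] ?].
have odd_ab : odd (\sum_k a k) (+) odd (\sum_k b k).
  by rewrite -oddD -big_split /= (eq_bigr _ (fun k _ => sum1 k)) sum1_card card_ord.
rewrite big_setU1 ?inE //= big_set1 !ffunE.
by case: (odd _) (odd _) odd_ab => [] []; rewrite ?mul0r ?mulr0.
Qed.

Definition bit_index (s : seq bool) : mindex 3 2 :=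
  [ffun k : 'I_3 => inord (nth false s k)].

Lemma bit_indexE s k : bit_index s k = nth false s k :> nat.
Proof. by rewrite ffunE inordK //; case: nth. Qed.

(** The even triple (p, q, p + q), in the copy labelled (q, p, p): labels
    chosen so that each coordinate determines both p and q. *)
Definition lifted_triple (t : bool * bool) : mindex 3 (2 * 2) :=
  let: (p, q) := t in
  kron_pair (bit_index [:: q; p; p]) (bit_index [:: p; q; p (+) q]).

Lemma lifted_tripleE p q k :
  lifted_triple (p, q) k =
    (nth false [:: q; p; p] k * 2 + nth false [:: p; q; p (+) q] k)%N :> nat.
Proof. by rewrite ffunE /= !bit_indexE. Qed.

Lemma lifted_triple_inj k : injective (fun t => lifted_triple t k).
Proof.
move=> [p q] [p' q'] /(congr1 val) /=; rewrite !lifted_tripleE.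
by case: k => [[|[|[|]]] //= _]; move: p q p' q' => [] [] [] [].
Qed.

Theorem mainTheorem10 (R : realType) :
  exists (n1 n2 : nat) (A : mdmatrix R 3 n1) (B : mdmatrix R 3 n2),
    [/\ (0 < n1)%N, (0 < n2)%N, nonneg_mdmatrix A & nonneg_mdmatrix B] /\
    per B = 0 /\ 0 < per (kron A B).
Proof.
pose A : mdmatrix R 3 2 := [ffun=> 1].
have A_ge0 : nonneg_mdmatrix A by move=> alpha; rewrite ffunE.
have B_ge0 : nonneg_mdmatrix (even_matrix R) by move=> beta; rewrite ffunE ler0n.
exists 2%N, 2%N, A, (even_matrix R); split; first by split.
split; first exact: per_even_matrix.
apply: (@per_gt0 _ _ _ _ [set lifted_triple t | t : bool * bool]).
- exact: nonneg_kron.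
- apply: image_is_diagonal => //; last exact: lifted_triple_inj.
  by rewrite card_prod card_bool.
- move=> _ /imsetP[[p q] _ ->]; rewrite kronE 2!ffunE mul1r.
  rewrite (eq_bigr _ (fun k _ => bit_indexE _ k)) !big_ord_recl big_ord0 /=.
  by case: p q => [] [] /=; rewrite ltr01.
Qed.
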